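(* For every prime $N$ and every integer $m\ge2$ one has $S(m,N)\ge S^{\mathbb{Z}}(m,N)$.
   Context: Let $N$ be prime, $m\ge2$, $\mathbb{Z}_N=\mathbb{Z}/N\mathbb{Z}$ with elements identified with $0,\dots,N-1$. A hyperplane in $\mathbb{Z}_N^m$ is a set $H=\{x:h\cdot x=0\}$ for a nonzero normal $h\in\mathbb{Z}_N^m$. Let $n(H)$ be the minimum, over all normals $h$ defining $H$, of the integer $\sum_{i=1}^m h_i$ (sum of representatives in $\{0,\dots,N-1\}$). Index all hyperplanes of $\mathbb{Z}_N^m$ as $H_1,H_2,\dots$ so that $n(H_1)\le n(H_2)\le\cdots$ and put $S(m,N)=\sum_{i=1}^{N+1}n(H_i)$, the sum of the $N+1$ smallest values of $n$ (there are at least $N+1$ hyperplanes). Let $c_i(m)$ be the number of $(x_1,\dots,x_m)\in\mathbb{Z}_{\ge0}^m$ with $\sum_j x_j=i$ and $\gcd(x_1,\dots,x_m)=1$. Let $k=k^{\mathbb{Z}}_{m,N}=\min\{k\ge0:\sum_{i=1}^{k+1}c_i(m)>N+1\}$ and $$S^{\mathbb{Z}}(m,N)=\sum_{i=1}^{k}i\,c_i(m)+\Bigl(N+1-\sum_{i=1}^{k}c_i(m)\Bigr)(k+1).$$ *)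

(* Defs.v *)
From mathcomp Require Import all_boot all_order all_algebra.

Set Implicit Arguments.
Unset Strict Implicit.
Unset Printing Implicit Defensive.

Import GRing.Theory.

Section Hyperplanes.
Variables m N : nat.

Definition dot (h x : 'rV['F_N]_m) : 'F_N := (\sum_i h ord0 i * x ord0 i)%R.

Definition hyperplane (h : 'rV['F_N]_m) : {set 'rV['F_N]_m} :=
  [set x | dot h x == 0%R].

Definition normal_of (H : {set 'rV['F_N]_m}) (h : 'rV['F_N]_m) : bool :=
  (h != 0%R) && (H == hyperplane h).

Definition hyperplanes : {set {set 'rV['F_N]_m}} :=
  [set H | [exists h, normal_of H h]].

(* The sum is over nat: val is the representative of an element of 'F_N, which
   lies in {0, ..., N-1} when N is prime. *)
Definition weight (h : 'rV['F_N]_m) : nat := \sum_i val (h ord0 i).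

Lemma normal_weight_exists (H : {set 'rV['F_N]_m}) : H \in hyperplanes ->
  exists w : nat, [exists h, normal_of H h && (weight h == w)].
Proof.
rewrite inE => /existsP[h Hh]; exists (weight h).
by apply/existsP; exists h; rewrite Hh eqxx.
Qed.

(* The minimum of the weights of the normals defining H; junk value 0 when H is
   not a hyperplane. *)
Definition n_of (H : {set 'rV['F_N]_m}) : nat :=
  if @idP (H \in hyperplanes) is ReflectT HH
  then ex_minn (normal_weight_exists HH) else 0.

Lemma n_ofP (H : {set 'rV['F_N]_m}) : H \in hyperplanes ->
  (exists2 h, normal_of H h & weight h = n_of H) /\
  (forall h, normal_of H h -> n_of H <= weight h).
Proof.
rewrite /n_of; case: {-}_ / idP => // HH _.
case: ex_minnP => w /existsP[h /andP[Hh /eqP hw]] wmin; split; first by exists h.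
move=> h' Hh'; apply: wmin.
by apply/existsP; exists h'; rewrite Hh' eqxx.
Qed.

(* The sequence H_1, H_2, ... of all hyperplanes, by nondecreasing n. *)
Definition ordered_hyperplanes : seq {set 'rV['F_N]_m} :=
  sort (fun H K => n_of H <= n_of K) (enum hyperplanes).

Definition S_hyp : nat := \sum_(H <- take N.+1 ordered_hyperplanes) n_of H.

End Hyperplanes.

(* Tuples of nonnegative integers of sum i have all entries at most i, hence the
   finite codomain 'I_i.+1. *)
Definition c (m i : nat) : nat :=
  #|[set x : {ffun 'I_m -> 'I_i.+1} |
      (\sum_j val (x j) == i) && (\big[gcdn/0]_j val (x j) == 1)]|.

Lemma c_gt0 (m i : nat) : 1 < m -> 0 < i -> 0 < c m i.
Proof.
case: m => [|[|m]] // _; case: i => // i _; rewrite /c card_gt0.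
apply/set0Pn.
exists [ffun j => if val j == 0 then inord 1 else if val j == 1 then inord i
                  else ord0].
rewrite inE !big_ord_recl !ffunE /= !inordK // !big1 //; last first.
- by move=> j _; rewrite ffunE.
- by move=> j _; rewrite ffunE.
by rewrite addn0 add1n eqxx gcd1n.
Qed.

Lemma kZ_exists (m N : nat) : 1 < m ->
  exists k, N.+1 < \sum_(1 <= i < k.+2) c m i.
Proof.
move=> hm; exists N.+1.
suff H k : k <= \sum_(1 <= i < k.+1) c m i by exact: H.
elim: k => // k IH; rewrite big_nat_recr //= -[k.+1 in X in X <= _]addn1.
by rewrite leq_add // c_gt0.
Qed.

Definition kZ (m N : nat) (hm : 1 < m) : nat := ex_minn (kZ_exists N hm).

(* The truncated subtraction is exact: by minimality of kZ the subtracted sum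
   is at most N + 1. *)
Definition S_Z (m N : nat) (hm : 1 < m) : nat :=
  let k := kZ N hm in
  \sum_(1 <= i < k.+1) i * c m i +
  (N.+1 - \sum_(1 <= i < k.+1) c m i) * k.+1.

(* Main.v *)
Require Import Defs.
From mathcomp Require Import all_boot all_order all_algebra.

(** A normal [h] of minimal weight of a hyperplane [H] has coprime coordinates:
    a common divisor [g > 1] of the representatives is a unit modulo [N], so
    [h / g] would be a lighter normal of [H].  As [h] determines [H], at most
    [c m i] hyperplanes satisfy [n(H) = i], for each [i].  Summing
    [n(H) + (k + 1 - n(H)) >= k + 1], with truncated subtraction, over any
    [N + 1] hyperplanes gives the bound, because these counts bound the sum of
    the truncated differences by [\sum_(i <= k) (k + 1 - i) c_i]. *)

Set Implicit Arguments.
Unset Strict Implicit.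
Unset Printing Implicit Defensive.

Import GRing.Theory.

Section Hyperplanes.
Variables m N : nat.
Hypothesis N_prime : prime N.
Implicit Types (h x : 'rV['F_N]_m) (H : {set 'rV['F_N]_m}).

Lemma val_Fp_lt (a : 'F_N) : val a < N.
Proof. by rewrite -[X in _ < X](Fp_cast N_prime) ltn_ord. Qed.

Lemma weight_eq0 h : (weight h == 0) = (h == 0%R).
Proof.
rewrite /weight sum_nat_eq0; apply/forallP/eqP => [h0|-> i]; last by rewrite mxE.
apply/rowP => i; rewrite mxE; apply: val_inj.
by move/eqP: (h0 i).
Qed.

Lemma hyperplaneZ (a : 'F_N) h : a != 0%R -> hyperplane (a *: h) = hyperplane h.
Proof.
move=> a_neq0; apply/setP => x; rewrite !inE.
have -> : dot (a *: h) x = (a * dot h x)%R.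
  by rewrite /dot big_distrr /=; apply: eq_bigr => i _; rewrite mxE mulrA.
by rewrite mulf_eq0 (negbTE a_neq0).
Qed.

Lemma gcd_min_normal H h : normal_of H h ->
  (forall h', normal_of H h' -> weight h <= weight h') ->
  \big[gcdn/0]_j val (h ord0 j) = 1.
Proof.
move=> /andP[h_neq0 /eqP defH] hmin.
set g := \big[gcdn/0]_j val (h ord0 j).
have g_dvd j : g %| val (h ord0 j).
  by rewrite /g (bigD1 j) //= dvdn_gcdl.
(* A nonzero coordinate has a representative between 1 and [N - 1] that [g] divides, so [0 < g < N]
   and [g] is invertible modulo [N]. *)
have [j hj_neq0] : exists j, h ord0 j != 0%R.
  apply/existsP; rewrite -[X in is_true X]negbK negb_exists.
  apply: contra h_neq0 => /forallP h0; apply/eqP/rowP => j.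
  by rewrite mxE; apply/eqP; rewrite -[X in is_true X]negbK h0.
have hj_gt0 : 0 < val (h ord0 j).
  by rewrite lt0n; apply: contra hj_neq0 => /eqP hj0; apply/eqP/val_inj.
have g_gt0 : 0 < g := dvdn_gt0 hj_gt0 (g_dvd j).
have g_ltN : g < N := leq_ltn_trans (dvdn_leq hj_gt0 (g_dvd j)) (val_Fp_lt _).
have gR_neq0 : (g%:R : 'F_N)%R != 0%R.
  apply/eqP => /(congr1 val); rewrite /= val_Fp_nat // modn_small // => g0.
  by rewrite g0 in g_gt0.
pose h' : 'rV['F_N]_m := (\row_j (val (h ord0 j) %/ g)%:R)%R.
(* The quotients stay below [N], so no reduction occurs and weights scale exactly by [g]. *)
have val_h' i : val (h' ord0 i) = val (h ord0 i) %/ g.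
  rewrite mxE /= val_Fp_nat // modn_small //.
  exact: leq_ltn_trans (leq_div _ _) (val_Fp_lt _).
have def_h : h = (g%:R *: h')%R.
  apply/rowP => i; rewrite !mxE -natrM mulnC divnK //.
  by apply: val_inj; rewrite /= val_Fp_nat // modn_small ?val_Fp_lt.
have normal_h' : normal_of H h'.
  apply/andP; split; last by rewrite defH def_h hyperplaneZ.
  by apply: contra h_neq0 => /eqP h'0; rewrite def_h h'0 scaler0.
have weight_h : weight h = weight h' * g.
  rewrite /weight big_distrl /=; apply: eq_bigr => i _.
  by rewrite -[LHS](divnK (g_dvd i)) -val_h'.
have w'_gt0 : 0 < weight h' by rewrite lt0n weight_eq0; case/andP: normal_h'.
have := hmin _ normal_h'; rewrite weight_h -[X in _ <= X]muln1 leq_pmul2l //.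
by move=> g_le1; apply/eqP; rewrite eqn_leq g_le1.
Qed.

(** Lets the counts by value of [n_of] start at [i = 1], as the sums of [c m i] do. *)
Lemma n_of_gt0 H : H \in hyperplanes m N -> 0 < n_of H.
Proof.
move=> /n_ofP[[h /andP[h_neq0 _] <-] _].
by rewrite lt0n weight_eq0.
Qed.

(** Sending [H] to the representatives of a chosen minimal normal is injective, since the normal
    determines [H], and lands in the coprime tuples of sum [i]. *)
Lemma card_n_of_le i :
  #|[set H in hyperplanes m N | n_of H == i]| <= c m i.
Proof.
(* The default [0] is never reached when [H] is a hyperplane. *)
pose min_normal H := odflt 0%R [pick h | normal_of H h && (weight h == n_of H)].
have min_normalP H : H \in hyperplanes m N ->
    normal_of H (min_normal H) /\ weight (min_normal H) = n_of H.
  move=> /n_ofP[[h Hh wh] _]; rewrite /min_normal.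
  case: pickP => [h' /andP[? /eqP ?] //|/(_ h)].
  by rewrite Hh wh eqxx.
pose f H : {ffun 'I_m -> 'I_i.+1} := [ffun j => inord (val (min_normal H ord0 j))].
(* [inord] is exact here: a coordinate is at most the weight, which equals [i]. *)
have fE H j : H \in hyperplanes m N -> n_of H = i ->
    val (f H j) = val (min_normal H ord0 j).
  move=> HH nH; rewrite ffunE /= inordK // ltnS -nH.
  by have [_ <-] := min_normalP H HH; rewrite /weight (bigD1 j) //= leq_addr.
rewrite /c -(@card_in_imset _ _ f); last first.
  move=> H K /setIdP[HH /eqP nH] /setIdP[HK /eqP nK] eq_f.
  have [/andP[_ /eqP ->] _] := min_normalP H HH.
  have [/andP[_ /eqP ->] _] := min_normalP K HK.
  congr hyperplane; apply/rowP => j; apply: val_inj.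
  by rewrite -!fE // eq_f.
apply/subset_leq_card/subsetP => _ /imsetP[H /setIdP[HH /eqP nH] ->].
have [normH weightH] := min_normalP H HH.
rewrite inE; apply/andP; split.
  rewrite (eq_bigr (fun j => val (min_normal H ord0 j))) => [|j _]; last exact: fE.
  by rewrite -[X in _ == X]nH -weightH.
rewrite (eq_bigr (fun j => val (min_normal H ord0 j))) => [|j _]; last exact: fE.
apply/eqP/(gcd_min_normal normH) => h' /(proj2 (n_ofP HH)).
by rewrite weightH.
Qed.

End Hyperplanes.

(* The pencil of normals [(1, a, 0, ...)] and [(0, 1, 0, ...)], separated by the
   points [(-a, 1, 0, ...)] and [(1, 0, 0, ...)]. *)
Lemma card_hyperplanes_ge m N : prime N -> 1 < m -> N < #|hyperplanes m N|.
Proof.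
case: m => [|[|m]] // N_prime _.
pose pt (a b : 'F_N) : 'rV['F_N]_m.+2 :=
  (\row_j (if val j == 0 then a else if val j == 1 then b else 0))%R.
have dot_pt a b a' b' : dot (pt a b) (pt a' b') = (a * a' + b * b')%R.
  rewrite /dot !big_ord_recl !mxE /= big1 ?addr0 // => j _.
  by rewrite !mxE /= mul0r.
pose nrm (o : option 'F_N) := if o is Some a then pt 1%R a else pt 0%R 1%R.
pose x (o : option 'F_N) := if o is Some a then pt (- a)%R 1%R else pt 1%R 0%R.
have nrm_x o o' : (dot (nrm o) (x o') == 0%R) = (o == o').
  case: o o' => [a|] [b|] /=; rewrite dot_pt ?mulr1 ?mul1r ?mul0r ?mulr0.
  - by rewrite addrC subr_eq0.
  - by rewrite addr0 oner_eq0.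
  - by rewrite add0r oner_eq0.
  - by rewrite addr0 eqxx.
have nrm_neq0 o : nrm o != 0%R.
  (* If [nrm o] vanished, it would pair to zero with [x o'] for every [o'], whereas [nrm_x] allows
     this only for [o' = o]. *)
  have [o' neq_o] : exists o', o != o'.
    by case: o => [a|]; [exists None | exists (Some 0%R)].
  apply: contra neq_o => /eqP nrm0; rewrite -nrm_x nrm0 /dot big1 // => j _.
  by rewrite mxE mul0r.
have hyp_inj : injective (fun o => hyperplane (nrm o)).
  move=> o o' /setP /(_ (x o')); rewrite !inE !nrm_x eqxx.
  by move=> /eqP.
have <- : #|{: option 'F_N}| = N.+1 by rewrite card_option card_Fp.
rewrite -(card_imset _ hyp_inj); apply/subset_leq_card/subsetP => _ /imsetP[o _ ->].
by rewrite inE; apply/existsP; exists (nrm o); rewrite /normal_of nrm_neq0 eqxx.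
Qed.

Lemma sum_n_of_ge m N k (s : seq {set 'rV['F_N]_m}) : prime N -> uniq s ->
  {subset s <= hyperplanes m N} ->
  size s * k.+1 <= \sum_(H <- s) n_of H + \sum_(1 <= i < k.+1) (k.+1 - i) * c m i.
Proof.
move=> N_prime s_uniq s_hyp.
have count_le i : \sum_(H <- s) (n_of H == i) <= c m i.
  apply: leq_trans (card_n_of_le m N_prime i).
  rewrite -(big_mkcond (fun H => n_of H == i) (fun=> 1)) sum1_count -size_filter.
  rewrite cardE uniq_leq_size ?filter_uniq // => H.
  by rewrite mem_filter mem_enum inE => /andP[-> /s_hyp ->].
apply: leq_trans (_ : \sum_(H <- s) (n_of H + (k.+1 - n_of H)) <= _).
  rewrite mulnC -sum1_size big_distrr /=; apply: leq_sum => H _.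
  by rewrite muln1 -leq_subLR.
rewrite big_split leq_add2l /=.
(* Each truncated difference is spread over the possible values [i] of [n_of H]; it is zero once
   [n_of H > k], so [i <= k] suffices. *)
apply: leq_trans (_ : \sum_(H <- s) \sum_(1 <= i < k.+1)
                        (k.+1 - i) * (n_of H == i) <= _).
  rewrite !big_seq; apply: leq_sum => H /s_hyp /n_of_gt0 nH_gt0.
  have [nH_le|] := ltnP (n_of H) k.+1; last by rewrite -subn_eq0 => /eqP ->.
  rewrite (bigD1_seq (n_of H)) ?mem_index_iota ?nH_gt0 ?iota_uniq //=.
  by rewrite eqxx muln1 leq_addr.
rewrite exchange_big /=; apply: leq_sum => i _.
by rewrite -big_distrr leq_mul2l count_le orbT.
Qed.

(** Otherwise the predecessor of [kZ N hm] would already satisfy the defining condition; when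
    [kZ N hm] is 0 the sum is empty. *)
Lemma sum_c_kZ_le m N (hm : 1 < m) : \sum_(1 <= i < (kZ N hm).+1) c m i <= N.+1.
Proof.
rewrite /kZ; case: ex_minnP => [[|k]] _ kmin; first by rewrite big_nil.
by rewrite leqNgt; apply/negP => /kmin; rewrite ltnn.
Qed.

Theorem lemma2p19 (N m : nat) (hN : prime N) (hm : 1 < m) :
  S_Z N hm <= S_hyp m N.
Proof.
set k := kZ N hm; set s := take N.+1 (ordered_hyperplanes m N).
have s_size : size s = N.+1.
  by rewrite size_takel // size_sort -cardE card_hyperplanes_ge.
have s_uniq : uniq s by rewrite take_uniq // sort_uniq enum_uniq.
have s_hyp : {subset s <= hyperplanes m N}.
  by move=> H /mem_take; rewrite mem_sort mem_enum.
have := sum_n_of_ge k hN s_uniq s_hyp; rewrite s_size => sum_ge.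
(* With this sum added, [i + (k.+1 - i) = k.+1] makes the left side collapse to exactly
   [N.+1 * k.+1]. *)
rewrite -(leq_add2r (\sum_(1 <= i < k.+1) (k.+1 - i) * c m i)).
apply: leq_trans sum_ge; rewrite /S_Z -/k addnAC -big_split /=.
rewrite (eq_big_nat _ _ (F2 := fun i => k.+1 * c m i)) => [|i /andP[_ i_le]].
  by rewrite -big_distrr /= mulnC -mulnDl subnKC ?sum_c_kZ_le // mulnC.
by rewrite -mulnDl subnKC // ltnW.
Qed.
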